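(* In constructive mathematics, consider the statement: ''For any set $X$ with a binary relation $<$, if for all $x,y\in X$, $x\leq_{N}y$ implies $x\leq_{P}y$, then $<$ is cotransitive.'' This statement implies the weak law of excluded middle: for every proposition $P$, either $\neg P$ or $\neg\neg P$.
   Context: The setting is constructive mathematics: no use of the law of excluded middle. For a set $X$ with a binary relation $<$ and $x,y\in X$: $x\leq_{P}y$ means that for all $z\in X$, $z<x$ implies $z<y$, and $y<z$ implies $x<z$; $x\leq_{N}y$ means $\neg(y<x)$. The relation $<$ is cotransitive if for all $x,y,z\in X$, $x<y$ implies $x<z$ or $z<y$. *)

(* Defs.v *)
Definition leP {X : Type} (lt : X -> X -> Prop) (x y : X) : Prop :=
  forall z : X, (lt z x -> lt z y) /\ (lt y z -> lt x z).

Definition leN {X : Type} (lt : X -> X -> Prop) (x y : X) : Prop :=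
  ~ lt y x.

Definition cotransitive {X : Type} (lt : X -> X -> Prop) : Prop :=
  forall x y z : X, lt x y -> lt x z \/ lt z y.

(* Main.v *)
Require Import Defs.

Inductive three : Set := bot | mid | top.

(* Cotransitivity of [bot < top] at [mid] is literally [~ P \/ ~ ~ P].  The
   propositions placed on the two short edges are negations, hence stable, and
   each is the negation of the other up to equivalence: this is what makes
   [leN] imply [leP] without excluded middle. *)
Definition wlem_lt (P : Prop) (x y : three) : Prop :=
  match x, y with
  | bot, mid => ~ P
  | mid, top => ~ ~ P
  | bot, top => True
  | _, _ => False
  end.

(** Only the descending pairs have content. For [mid], [bot] the hypothesis is [~ ~ P], which
    refutes the lower short edge and is itself the upper one. For [top], [mid] it is [~ ~ ~ P], with
    the roles of the edges swapped. For [top], [bot] it is absurd. *)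
Lemma wlem_lt_leN_leP (P : Prop) (x y : three) :
  leN (wlem_lt P) x y -> leP (wlem_lt P) x y.
Proof.
  (* The least immediate goal, at [top], [mid], [bot], is the intuitionistic law
     [~ ~ ~ P -> ~ P]. *)
  unfold leN, leP; destruct x, y; intros H z; destruct z; simpl in *; tauto.
Qed.

Theorem theorem4 :
  (forall (X : Type) (lt : X -> X -> Prop),
     (forall x y : X, leN lt x y -> leP lt x y) -> cotransitive lt) ->
  forall P : Prop, ~ P \/ ~ ~ P.
Proof.
  intros H P.
  exact (H three (wlem_lt P) (wlem_lt_leN_leP P) bot top mid I).
Qed.
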